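(* The Wendland kernel $$K_w(x,y)=\max\{1-|x-y|,0\}=1-|x-y|,\qquad x,y\in(0,1),$$ satisfies (A4$'$): for all $m\in\mathbb N$ and all pairwise distinct $x_1,\dots,x_m,x_{m+1}\in(0,1)$, with $\mathbf x=\{x_1,\dots,x_m\}$, $$\|K_w[\mathbf x]^{-1}(K_w)_{\mathbf x}(x_{m+1})\|_1\le 1.$$
   Context: For pairwise distinct $\mathbf x=\{x_1,\dots,x_m\}$, $K_w[\mathbf x]$ is the $m\times m$ matrix $[K_w(x_i,x_j)]_{i,j}$ (which is invertible, being strictly positive definite), $(K_w)_{\mathbf x}(x)=(K_w(x,x_1),\dots,K_w(x,x_m))^T$, and $\|\cdot\|_1$ is the $\ell^1$-norm on $\mathbb R^m$. *)

(* Defs.v *)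
From mathcomp Require Import all_boot all_order all_algebra.
From mathcomp Require Import reals.
Set Implicit Arguments.
Unset Strict Implicit.
Unset Printing Implicit Defensive.
Import Order.TTheory GRing.Theory Num.Theory.
Local Open Scope ring_scope.

Definition kernel_mx (R : realType) (T : Type) (K : T -> T -> R) (m : nat)
    (x : 'I_m -> T) : 'M[R]_m :=
  \matrix_(i < m, j < m) K (x i) (x j).

Definition kernel_vec (R : realType) (T : Type) (K : T -> T -> R) (m : nat)
    (x : 'I_m -> T) (t : T) : 'cV[R]_m :=
  \col_(i < m) K t (x i).

Definition l1norm (R : realType) (m : nat) (v : 'cV[R]_m) : R :=
  \sum_(i < m) `|v i 0|.

(* The points x_1, ..., x_m, x_(m+1) are x 0, ..., x (m - 1), x m. *)
Definition init_points (T : Type) (m : nat) (x : 'I_m.+1 -> T) : 'I_m -> T :=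
  fun i => x (widen_ord (leqnSn m) i).

(* [invmx A] is the inverse of [A] only when [A \in unitmx]; the condition is
   meant for kernels whose matrices at distinct points of [D] are invertible. *)
Definition condition_A4' (R : realType) (T : Type) (D : pred T)
    (K : T -> T -> R) : Prop :=
  forall (m : nat) (x : 'I_m.+1 -> T),
    injective x -> (forall i, D (x i)) ->
    l1norm (invmx (kernel_mx K (init_points x))
            *m kernel_vec K (init_points x) (x ord_max)) <= 1.

Definition wendland (R : realType) (x y : R) : R := Num.max (1 - `|x - y|) 0.

(* Main.v *)
Require Import Defs.
From mathcomp Require Import all_boot all_order all_algebra.
From mathcomp Require Import reals.
From mathcomp Require Import lra ring.
Import Order.TTheory GRing.Theory Num.Theory.
Local Open Scope ring_scope.

(** For every finite set of nodes in (0,1) and every further point t, the kernel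
    function at t agrees on the nodes with a combination alpha k_a + beta k_b
    of at most two kernel functions, where |alpha| + |beta| <= 1: if t lies
    between two neighbouring nodes a and b this is linear interpolation, and
    if t lies outside the hull [a, b] of the nodes it is the solution of a
    two-by-two system. This gives (A4') once the kernel matrix is invertible.
    Invertibility also follows: expressing k_t at t = x_i by the other nodes
    and subtracting, a left null vector v of the kernel matrix satisfies
    v_i (1 - alpha k(x_i, a) - beta k(x_i, b)) = 0, and the second factor is
    positive because k < 1 off the diagonal. *)

Lemma wendlandE (R : realType) (x y : R) :
  0 < x < 1 -> 0 < y < 1 -> wendland x y = 1 - `|x - y|.
Proof.
move=> hx hy; rewrite /wendland; apply/max_idPl.
by rewrite subr_ge0 ler_norml; lra.
Qed.

Section TwoNodes.
Variables (R : realType) (I : finType).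
Implicit Types (x : I -> R) (t : R) (P : pred I).

(** [P] selects the admissible nodes: all of them for (A4'), all but one for invertibility. [a] and
    [b] may coincide, as they must for a single node. *)
Definition two_node_combination P x t := exists a b (al be : R),
  [/\ P a, P b, `|al| + `|be| <= 1
    & forall l, P l ->
        al * (1 - `|x l - x a|) + be * (1 - `|x l - x b|) = 1 - `|x l - t|].

Lemma two_node_reflect P x t :
  two_node_combination P (fun i => 1 - x i) (1 - t) ->
  two_node_combination P x t.
Proof.
move=> [a [b [al [be [Pa Pb h e]]]]]; exists a, b, al, be; split=> // l Pl.
have E u v : `|(1 - u) - (1 - v)| = `|u - v| :> R.
  by rewrite (_ : 1 - u - (1 - v) = v - u) 1?distrC //; ring.
by move: (e l Pl); rewrite !E.
Qed.

Lemma two_node_left P x t i0 :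
  P i0 -> (forall i, P i -> 0 < x i < 1) -> 0 < t < 1 ->
  (forall i, P i -> x i < t) -> two_node_combination P x t.
Proof.
move=> Pi0 x01 t01 xt.
case: (arg_minP x Pi0) => a Pa mina; case: (arg_maxP x Pi0) => b Pb maxb.
have d_gt0 : 0 < 2 + x a - x b by move: (x01 _ Pa) (x01 _ Pb); lra.
have tb := xt _ Pb.
(* On the hull of the nodes the kernel functions at [x b], [x a], [t] are affine with slopes 1, -1,
   1. Matching slopes ([al - be = 1]) and constant terms gives these weights; their absolute values
   sum to exactly 1. *)
exists b, a, ((2 + x a - t) / (2 + x a - x b)), (- ((t - x b) / (2 + x a - x b))).
split=> //.
  have ta_ge0 : 0 <= 2 + x a - t by move: (x01 _ Pa); lra.
  have tb_ge0 : 0 <= t - x b by lra.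
  rewrite normrN !ger0_norm ?(divr_ge0 _ (ltW d_gt0)) //.
  by rewrite -mulrDl ler_pdivrMr //; lra.
move=> l Pl; have lb : x l <= x b by apply: maxb.
rewrite (ler0_norm (_ : x l - x b <= 0)) ?subr_le0 //.
rewrite (ger0_norm (_ : 0 <= x l - x a)) ?subr_ge0 ?mina //.
rewrite (ltr0_norm (_ : x l - t < 0)) ?subr_lt0 ?xt //.
by field; rewrite gt_eqF.
Qed.

Lemma two_node_between P x t i0 j0 :
  P i0 -> x i0 < t -> P j0 -> t < x j0 -> (forall i, P i -> x i != t) ->
  two_node_combination P x t.
Proof.
move=> Pi0 i0t Pj0 j0t xt.
have Qi0 : (P i0 && (x i0 < t)) by rewrite Pi0.
have Qj0 : (P j0 && (t < x j0)) by rewrite Pj0.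
case: (@arg_maxP _ _ _ i0 (fun i => P i && (x i < t)) x Qi0)
  => a /andP[Pa at_] maxa.
case: (@arg_minP _ _ _ j0 (fun i => P i && (t < x i)) x Qj0)
  => b /andP[Pb tb] minb.
have d_gt0 : 0 < x b - x a by lra.
(* No node lies strictly between [x a] and [x b], so for each node the distance to s is affine in s
   on this interval, and the convex weights of [t] interpolate exactly. *)
exists a, b, ((x b - t) / (x b - x a)), ((t - x a) / (x b - x a)); split=> //.
  rewrite !ger0_norm ?(divr_ge0 _ (ltW d_gt0)) ?subr_ge0 ?(ltW at_) ?(ltW tb) //.
  by rewrite -mulrDl ler_pdivrMr //; lra.
move=> l Pl; have [lt|tl|e] := ltgtP (x l) t; last by move: (xt l Pl); rewrite e eqxx.
- have la : x l <= x a by apply: maxa; rewrite Pl.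
  rewrite !ler0_norm ?subr_le0 //; [|by lra..].
  by field; rewrite gt_eqF.
- have bl : x b <= x l by apply: minb; rewrite Pl.
  rewrite !ger0_norm ?subr_ge0 //; [|by lra..].
  by field; rewrite gt_eqF.
Qed.

Lemma two_nodeP P x t i0 :
  P i0 -> (forall i, P i -> 0 < x i < 1) -> 0 < t < 1 ->
  (forall i, P i -> x i != t) -> two_node_combination P x t.
Proof.
move=> Pi0 x01 t01 xt.
have [/existsP[i /andP[Pi it]]|/existsPn nl] := boolP [exists i, P i && (x i < t)].
  have [/existsP[j /andP[Pj tj]]|/existsPn nr] := boolP [exists j, P j && (t < x j)].
    exact: (two_node_between _ _ _ _ _ Pi it Pj tj).
  apply: (two_node_left _ _ _ _ Pi0) => // j Pj.
  by move: (nr j); rewrite Pj /= -leNgt lt_neqAle xt.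
(* No node is left of [t]; the reflection of (0,1) about its midpoint preserves distances and moves
   all nodes to the left. *)
apply/two_node_reflect/(two_node_left _ _ _ _ Pi0) => [j Pj||j Pj].
- by move: (x01 j Pj); lra.
- by lra.
- move: (nl j); rewrite Pj /= -leNgt => tj.
  have : t < x j by rewrite lt_neqAle eq_sym xt.
  by lra.
Qed.

End TwoNodes.

Lemma kernel_mx_wendland_unit (R : realType) (m : nat) (x : 'I_m -> R) :
  injective x -> (forall i, 0 < x i < 1) ->
  kernel_mx (@wendland R) x \in unitmx.
Proof.
move=> x_inj x01; rewrite -row_free_unit; apply/inj_row_free => v vA0.
have v0 j : \sum_l v 0 l * (1 - `|x l - x j|) = 0.
  have /matrixP/(_ 0 j) := vA0; rewrite !mxE => {2}<-.
  by apply: eq_bigr => l _; rewrite mxE wendlandE.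
apply/rowP => i; rewrite mxE.
have [/existsP[i0 i0i]|/existsPn only_i] := boolP [exists j, j != i]; last first.
  have := v0 i; rewrite (bigD1 i) //= big1 => [|l li]; last by case/negP: (only_i l).
  by rewrite subrr normr0; lra.
have [|||a [b [al [be [ai bi albe e]]]]] := @two_nodeP R _ (fun j => j != i) x (x i) i0 i0i.
- by [].
- exact: x01.
- by move=> j ji; apply: contra ji => /eqP/x_inj ->.
(* [g] combines the columns [i], [a], [b], each annihilated by [v], and vanishes off [i]; hence
   [v 0 i * g i = 0]. *)
pose g l := (1 - `|x l - x i|) - (al * (1 - `|x l - x a|) + be * (1 - `|x l - x b|)).
have : \sum_l v 0 l * g l = 0.
  transitivity (\sum_l v 0 l * (1 - `|x l - x i|)
     - (al * (\sum_l v 0 l * (1 - `|x l - x a|))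
        + be * (\sum_l v 0 l * (1 - `|x l - x b|)))).
    rewrite !mulr_sumr -big_split -sumrB; apply: eq_bigr => l _ /=.
    by rewrite /g; ring.
  by rewrite !v0; ring.
rewrite (bigD1 i) //= big1 ?addr0 => [|l li]; last by rewrite /g e // subrr mulr0.
move/eqP; rewrite mulf_eq0 => /orP[/eqP //|].
have klt1 j : j != i -> 0 < 1 - `|x i - x j| < 1.
  move=> ji; have : 0 < `|x i - x j|.
    by rewrite normr_gt0 subr_eq0 eq_sym; apply: contra ji => /eqP/x_inj ->.
  have : `|x i - x j| < 1 by rewrite ltr_norml; move: (x01 i) (x01 j); lra.
  by lra.
suff : 0 < g i by move=> /gt_eqF ->.
rewrite /g subrr normr0; move: (klt1 _ ai) (klt1 _ bi).
set p := 1 - `|x i - x a|; set q := 1 - `|x i - x b| => hp hq.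
have bound (r u w : R) : 0 < u -> u <= w -> r * u <= `|r| * w.
  by move=> u0 uw; rewrite (le_trans (ler_norm _)) // normrM (gtr0_norm u0) ler_wpM2l.
(* A common bound [M] for both off-diagonal values gives [g i >= 1 - M > 0]. *)
have [M [pM qM M_lt1]] : exists M, [/\ p <= M, q <= M & M < 1].
  by exists (Num.max p q); rewrite !le_max !lexx orbT gt_max; split=> //; lra.
have := bound al p M (andP hp).1 pM; have := bound be q M (andP hq).1 qM.
have : (`|al| + `|be|) * M <= M by rewrite ler_piMl //; lra.
by rewrite mulrDl; lra.
Qed.

Theorem theorem5p2 (R : realType) :
  [/\ (forall x y : R, 0 < x < 1 -> 0 < y < 1 -> wendland x y = 1 - `|x - y|),
      (forall (m : nat) (x : 'I_m -> R),
         injective x -> (forall i, 0 < x i < 1) ->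
         kernel_mx (@wendland R) x \in unitmx)
    & condition_A4' (fun x : R => 0 < x < 1) (@wendland R)].
Proof.
split; [exact: wendlandE | exact: kernel_mx_wendland_unit |].
move=> [|m] x x_inj x01; first by rewrite /l1norm big_ord0.
set y := init_points x; set t := x ord_max.
have y01 i : 0 < y i < 1 by apply: x01.
have y_inj : injective y by move=> i j /x_inj/(congr1 val) /= /val_inj.
have yt i : y i != t.
  apply/eqP => /x_inj/(congr1 val) /= im.
  by have := ltn_ord i; rewrite im ltnn.
have [|||a [b [al [be [_ _ albe e]]]]] :=
  @two_nodeP R _ predT y t ord0 isT; [by [] | exact: x01 | by [] |].
pose c : 'cV[R]_m.+1 := al *: delta_mx a 0 + be *: delta_mx b 0.
have Kc : kernel_mx (@wendland R) y *m c = kernel_vec (@wendland R) y t.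
  apply/colP => l; rewrite mulmxDr -!scalemxAr -!colE !mxE !wendlandE //; last exact: x01.
  by rewrite e // distrC.
rewrite -Kc mulKmx ?kernel_mx_wendland_unit //.
have l1delta (r : R) i : \sum_j `|(r *: delta_mx i 0 : 'cV[R]_m.+1) j 0| = `|r|.
  rewrite (bigD1 i) //= big1 => [|j ji]; rewrite !mxE ?(negPf ji) ?eqxx /=.
    by rewrite mulr1 addr0.
  by rewrite mulr0 normr0.
(* If [a = b], the two entries of [c] merge, so the norm is bounded by the triangle inequality. *)
apply: le_trans albe; rewrite -(l1delta al a) -(l1delta be b) -big_split /=.
by apply: ler_sum => j _; rewrite [c j 0]mxE ler_normD.
Qed.
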